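(* Let $W_d\in\mathcal{D}$ and $\epsilon>0$. Then the Array Algorithm (given in the context) solves the writing problem within finite time $\hat T_{11}+\dots+\hat T_{mn}$; that is, for any initial flux vector $\varphi_0\in\mathbb{R}^{mn}$, every $\hat T_{kl}$ is finite, and at time $\hat T_{11}+\dots+\hat T_{mn}$ (the sum over all $k\in\{1,\dots,m\}$, $l\in\{1,\dots,n\}$) the flux vector $\varphi$ resulting from the voltages and switch settings generated by the algorithm satisfies $$|W_{d,kl}-W_{kl}(\varphi_{kl})|\le\epsilon\quad\text{for all }k\in\{1,\dots,m\},\ l\in\{1,\dots,n\}.$$
   Context: Fix positive integers $m,n$. For $k\in\{1,\dots,m\}$, $l\in\{1,\dots,n\}$ the memristor $M_{kl}$ is described by a function $g_{kl}:\mathbb{R}\to\mathbb{R}$ that is continuously differentiable and strictly monotone, i.e. $(g_{kl}(\varphi)-g_{kl}(\varphi'))(\varphi-\varphi')>0$ for all $\varphi\ne\varphi'$. Its memductance is $W_{kl}(\varphi)=\frac{dg_{kl}}{d\varphi}(\varphi)$. It is assumed that $W_{kl}$ is strictly monotone, i.e. $(W_{kl}(\varphi)-W_{kl}(\varphi'))(\varphi-\varphi')>0$ for all $\varphi\neq\varphi'$, and $\beta$-Lipschitz continuous, i.e. $|W_{kl}(\varphi)-W_{kl}(\varphi')|\le\beta|\varphi-\varphi'|$ for all $\varphi,\varphi'$, for some $\beta>0$. Vectors in $\mathbb{R}^{mn}$ are indexed by pairs $(k,l)$, with $\varphi_{kl}$ in position $k+m(l-1)$. The set of desired memductance matrices is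 $$\mathcal{D}=\{X\in\mathbb{R}_{>0}^{m\times n}\mid \exists\,\varphi\in\mathbb{R}^{mn}\text{ such that }X_{kl}=W_{kl}(\varphi_{kl})\text{ for all }k\in\{1,\dots,m\},\ l\in\{1,\dots,n\}\},$$ where $\mathbb{R}_{>0}^{m\times n}$ denotes the matrices with positive entries. $W_{d,kl}$ is the $(k,l)$ entry of $W_d$. The crossbar array has controlled voltage potentials $P_1^A,\dots,P_n^A$ at the column terminals, and the row terminals are grounded (zero potential). With switch states $s_{ij}\in\{0,1\}$, which may be changed over time, its dynamics are $$\tfrac{d}{dt}\varphi_{ij}=s_{ij}P_j^A,\qquad -J_i^B=\sum_{j=1}^n W_{ij}(\varphi_{ij})P_j^A s_{ij},$$ where $J_i^B$ is the current measured at row terminal $i$. When only switch $(k,l)$ is closed ($s_{kl}=1$, all other $s_{ij}=0$), this becomes $\frac{d}{dt}\varphi_{kl}=P_l^A$, $\frac{d}{dt}\varphi_{ij}=0$ for $(i,j)\ne(k,l)$, and $-J_k^B=W_{kl}(\varphi_{kl})P_l^A$. Differential equations with piecewise continuous inputs are understood in integral form. The initial memductances $W_{ij}(\varphi_{ij}(0))$ are assumed known. Writing problem: given a desired memductance value $W_{d,kl}$ for each memristor and $\epsilon>0$, for any $\varphi_0\in\mathbb{R}^{mn}$ find a final time, terminal voltage potentials and switch states as functions of time up to that final time, such that the solution of the array dynamics with $\varphi(0)=\varphi_0$ satisfies $|W_{d,kl}-W_{kl}(\varphi_{kl})|\le\epsilon$ for all $k,l$ at the final time. Single-Memristor Algorithm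 (with parameters $T>0$, $\alpha>0$, for memristor $M_{kl}$, time $t$ measured from the start of the algorithm). If $|W_{d,kl}-W_{kl}(\varphi_{kl}(0))|>\epsilon$, then (otherwise nothing is done): 1. Apply $P_l^A(t)=1$ for $t\in[0,T]$. 2. Set $i=1$. 3. Measure $J_k^B(iT)$. 4. If $\left|W_{d,kl}+J_k^B(iT)/P_l^A(iT)\right|\le\epsilon$, then stop. 5. Apply $P_l^A(t)=\alpha\left(W_{d,kl}+J_k^B(iT)/P_l^A(iT)\right)$ for $t\in(iT,(i+1)T]$. 6. Set $i=i+1$ and go to step 3. Array Algorithm. Let $\alpha>0$ and $T>0$ be such that $\alpha T<\frac{2}{\beta}$. 1. Let $k=1$, $l=1$. 2. Set the switches so that $s_{kl}=1$ and $s_{ij}=0$ for all $(i,j)\ne(k,l)$. 3. Apply the Single-Memristor Algorithm to $M_{kl}$. Let $\hat T_{kl}\ge0$ denote the time at which it stops, so that $|W_{d,kl}-W_{kl}(\varphi_{kl}(\hat T_{kl}))|\le\epsilon$ ($\hat T_{kl}=0$ if nothing needs to be done). 4. Reset the clock to $t=0$ (the current fluxes become the initial fluxes of the next stage). 5. If $k=m$ and $l=n$, then stop. 6. If $l\ne n$, let $l=l+1$; otherwise let $l=1$ and $k=k+1$. Go to step 2. *)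

(* Defs.v *)
From HB Require Import structures.
From mathcomp Require Import all_boot all_order all_algebra.
From mathcomp Require Import all_classical all_reals all_analysis.

Set Implicit Arguments.
Unset Strict Implicit.
Unset Printing Implicit Defensive.

Import Order.TTheory GRing.Theory Num.Theory.
Import numFieldNormedType.Exports.

Local Open Scope classical_set_scope.
Local Open Scope ring_scope.

Definition strictly_monotone (R : realType) (f : R -> R) : Prop :=
  forall x y, x != y -> 0 < (f x - f y) * (x - y).

Definition lipschitz_with (R : realType) (beta : R) (f : R -> R) : Prop :=
  forall x y, `|f x - f y| <= beta * `|x - y|.

Definition cont_differentiable (R : realType) (f : R -> R) : Prop :=
  (forall x, derivable f x 1) /\ continuous (derive1 f).

Definition memductance (R : realType) (m n : nat)
  (g : 'I_m -> 'I_n -> R -> R) (k : 'I_m) (l : 'I_n) : R -> R := derive1 (g k l).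

(* Fluxes are stored as m x n matrices rather than as their column-major
   vectorisations in R^(mn). *)
Definition desired_memductances (R : realType) (m n : nat)
  (g : 'I_m -> 'I_n -> R -> R) : set 'M[R]_(m, n) :=
  [set X | (forall k l, 0 < X k l) /\
     exists phi : 'M[R]_(m, n),
       forall k l, X k l = memductance g k l (phi k l)].

(* Signals are total functions of which only the restriction to [0, +oo[
   matters. *)
Definition piecewise_continuous (R : realType) (f : R -> R) : Prop :=
  [/\ forall b : R,
        finite_set [set t | 0 < t < b /\ ~ {for t, continuous f}],
      forall t : R, 0 <= t -> cvg (f x @[x --> t^'+])
    & forall t : R, 0 < t -> cvg (f x @[x --> t^'-])].

Definition admissible_inputs (R : realType) (m n : nat)
  (s : R -> 'M[bool]_(m, n)) (P : R -> 'rV[R]_n) : Prop :=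
  (forall i j, piecewise_continuous (fun t => (s t i j)%:R : R)) /\
  (forall j, piecewise_continuous (fun t => P t 0 j)).

(* The solution of d/dt phi_ij = s_ij P_j, phi(0) = phi0, in integral form: the
   right-hand side does not involve phi, so the integral form is explicit. *)
Definition flux (R : realType) (m n : nat) (phi0 : 'M[R]_(m, n))
  (s : R -> 'M[bool]_(m, n)) (P : R -> 'rV[R]_n) (t : R) : 'M[R]_(m, n) :=
  \matrix_(i, j) (phi0 i j +
    \int[lebesgue_measure]_(tau in `[0, t]) ((s tau i j)%:R * P tau 0 j)).

(* J_i^B, the current measured at row terminal i. *)
Definition row_current (R : realType) (m n : nat)
  (g : 'I_m -> 'I_n -> R -> R) (phi0 : 'M[R]_(m, n))
  (s : R -> 'M[bool]_(m, n)) (P : R -> 'rV[R]_n) (t : R) (i : 'I_m) : R :=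
  - \sum_(j < n)
      memductance g i j (flux phi0 s P t i j) * P t 0 j * (s t i j)%:R.

Definition solves_writing_problem (R : realType) (m n : nat)
  (g : 'I_m -> 'I_n -> R -> R) (Wd : 'M[R]_(m, n)) (eps : R)
  (phi0 : 'M[R]_(m, n)) (Tf : R)
  (s : R -> 'M[bool]_(m, n)) (P : R -> 'rV[R]_n) : Prop :=
  [/\ 0 <= Tf, admissible_inputs s P
    & forall k l,
        `|Wd k l - memductance g k l (flux phi0 s P Tf k l)| <= eps].

(* [single_memristor_algorithm alpha T eps wd w0 J P That]: on its own clock,
   for the desired value wd and the initial memductance w0, the algorithm
   measuring the current J applies the voltage P and stops at time That, with
   That = +oo when it never stops.  [unstopped i] says that the stopping test
   has failed at each of the sampling times T, 2T, ..., iT. *)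
Definition single_memristor_algorithm (R : realType) (alpha T eps wd w0 : R)
  (J P : R -> R) (That : \bar R) : Prop :=
  let err (i : nat) := wd + J (i%:R * T) / P (i%:R * T) in
  let unstopped (i : nat) := forall j : nat, (1 <= j <= i)%N -> eps < `|err j| in
  if `|wd - w0| <= eps then That = 0%E else
  [/\ forall t : R, 0 <= t <= T -> P t = 1,
      forall i : nat, (1 <= i)%N -> unstopped i ->
        forall t, i%:R * T < t <= i.+1%:R * T -> P t = alpha * err i
    & (exists i : nat, [/\ (1 <= i)%N, unstopped i.-1, `|err i| <= eps
                         & That = (i%:R * T)%:E])
      \/ ((forall i, unstopped i) /\ That = +oo%E)].

(* The order in which the array algorithm visits the memristors: l advances
   first, and k is incremented each time l wraps around. *)
Definition visited_before (m n : nat) (p q : 'I_m * 'I_n) : bool :=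
  (p.1 < q.1)%N || ((p.1 == q.1) && (p.2 < q.2)%N).

(* The global time at which the clock is reset for memristor (k, l); +oo if an
   earlier stage never stops. *)
Definition stage_start (R : realType) (m n : nat)
  (That : 'I_m -> 'I_n -> \bar R) (k : 'I_m) (l : 'I_n) : \bar R :=
  (\sum_(p : 'I_m * 'I_n | visited_before p (k, l)) That p.1 p.2)%E.

(* The stage of memristor (k, l), started at global time r.  [u] is the voltage
   P_l on the local clock t, which corresponds to the global time r + t.  At the
   global instant r the previous stage takes its last measurement, so r belongs
   to the previous stage, and the present one owns ]r, r + That k l]; the value
   at one instant does not affect the fluxes.  The voltages of the other columns
   are left free, as all their switches are open. *)
Definition array_stage (R : realType) (m n : nat)
  (g : 'I_m -> 'I_n -> R -> R) (Wd : 'M[R]_(m, n)) (eps alpha T : R)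
  (phi0 : 'M[R]_(m, n)) (s : R -> 'M[bool]_(m, n)) (P : R -> 'rV[R]_n)
  (That : 'I_m -> 'I_n -> \bar R) (k : 'I_m) (l : 'I_n) (r : R) : Prop :=
  (forall t : R, 0 < t -> (t%:E <= That k l)%E ->
     forall i j, s (r + t) i j = ((i == k) && (j == l))) /\
  exists u : R -> R,
    (forall t : R, 0 < t -> (t%:E <= That k l)%E -> P (r + t) 0 l = u t) /\
    single_memristor_algorithm alpha T eps (Wd k l)
      (memductance g k l (flux phi0 s P r k l))
      (fun t => row_current g phi0 s P (r + t) k) u (That k l).

(* [array_algorithm ... s P That]: started with fluxes phi0, the array algorithm
   generates the switch states s and the voltages P, and its stages have
   durations That.  A stage that is never reached gets the value +oo. *)
Definition array_algorithm (R : realType) (m n : nat)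
  (g : 'I_m -> 'I_n -> R -> R) (Wd : 'M[R]_(m, n)) (eps alpha T : R)
  (phi0 : 'M[R]_(m, n)) (s : R -> 'M[bool]_(m, n)) (P : R -> 'rV[R]_n)
  (That : 'I_m -> 'I_n -> \bar R) : Prop :=
  admissible_inputs s P /\
  forall k l,
    (forall r : R, stage_start That k l = r%:E ->
       array_stage g Wd eps alpha T phi0 s P That k l r) /\
    (stage_start That k l \isn't a fin_num -> That k l = +oo%E).

(* Main.v *)
(* At the sampling times the flux of the memristor being written obeys
   x_(i+1) = x_i + alpha T (Wd - W x_i) for i >= 1.  Taking xs with W xs = Wd,
   monotonicity and the Lipschitz bound show that (x_i - xs)^2 decreases by a
   fixed positive amount as long as |Wd - W x_i| > eps, because
   alpha T < 2 / beta; hence every stage stops.  All voltages are constant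
   between sampling times and all other switches are open, so a stage changes no
   other flux, and every flux rate is a step function whose integral can be
   computed piece by piece, without appealing to the piecewise continuity of the
   inputs.  Conversely, stacking the sampled recursions of the memristors in
   consecutive blocks of slots of length T constructs a run of the algorithm. *)

Require Import Defs.
From HB Require Import structures.
From mathcomp Require Import all_boot all_order all_algebra.
From mathcomp Require Import all_classical all_reals all_analysis.
From mathcomp Require Import measurable_realfun ring lra zify.

Set Implicit Arguments.
Unset Strict Implicit.
Unset Printing Implicit Defensive.

Import Order.TTheory GRing.Theory Num.Theory.
Import numFieldNormedType.Exports.

Local Open Scope classical_set_scope.
Local Open Scope ring_scope.

(** * Integrals of step functions *)

(** Integrability travels with the value because additivity over adjacent intervals needs it. *)
Definition integrates (R : realType) (f : R -> R) (t v : R) : Prop :=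
  lebesgue_measure.-integrable `[0, t] (EFin \o f) /\
  \int[lebesgue_measure]_(x in `[0, t]) f x = v.

Lemma integrates0 (R : realType) (f : R -> R) : integrates f 0 0.
Proof.
rewrite /integrates set_itv1 Rintegral_set1; split=> //.
apply/integrableP; split; first exact: measurable_fun_set1.
by rewrite integral_set1.
Qed.

(** Cutting at [a] into [[0, a]] and []a, b]] leaves the instant [a] with the earlier piece, as
    happens with the sampling times of the algorithm. *)
Lemma integrates_step (R : realType) (f : R -> R) (a b c v : R) :
  0 <= a -> a <= b -> (forall t, a < t <= b -> f t = c) ->
  integrates f a v -> integrates f b (v + (b - a) * c).
Proof.
move=> a0 ab fc [fi fv].
have mu_ab : lebesgue_measure `]a, b]%classic = (b - a)%:E.
  rewrite lebesgue_measure_itv/= lte_fin; case: ltP => // ba.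
  by rewrite (@le_anti _ _ b a) ?subrr// ba ab.
have fcE : {in `]a, b]%classic, cst c =1 f}.
  by move=> t; rewrite inE /= in_itv /= => /fc ->.
have ci : lebesgue_measure.-integrable `]a, b] (EFin \o f).
  apply: (@eq_integrable _ _ _ _ _ _ (EFin \o cst c)) => //.
    by move=> t /fcE /= <-.
  apply: measurable_bounded_integrable => //=; last exact: bounded_cst.
  by rewrite mu_ab ltry.
have U : `[0, b]%classic = `[0, a]%classic `|` `]a, b]%classic :> set R.
  by rewrite -itv_bndbnd_setU// bnd_simp.
have fU : lebesgue_measure.-integrable `[0, b] (EFin \o f).
  rewrite U; apply/integrableP; split.
    apply/measurable_funU => //; split;
      [exact: measurable_int fi|exact: measurable_int ci].
  rewrite ge0_integral_setU//.
  - move: fi ci => /integrableP[_ fi] /integrableP[_ ci].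
    by rewrite lte_add_pinfty.
  - apply: measurableT_comp => //.
    by apply/measurable_funU => //; split;
      [exact: measurable_int fi|exact: measurable_int ci].
  - apply/disj_setPLR => t /=; rewrite !in_itv/= => /andP[_ ta].
    by rewrite ltNge ta.
split => //; rewrite U Rintegral_setU//; last 2 first.
- by rewrite -U.
- by apply/disj_setPLR => t /=; rewrite !in_itv/= => /andP[_ ta]; rewrite ltNge ta.
rewrite fv -(eq_Rintegral lebesgue_measure fcE) Rintegral_cst//.
by rewrite [X in fine X]mu_ab mulrC.
Qed.

(** * Slots of length [T] and piecewise continuity *)

(* For [t > 0], the [q] such that [qT < t <= (q+1)T]; it is [0] at [t = 0] and
   a junk value for [t < 0]. *)
Definition slot (R : realType) (T t : R) : nat := `|Num.ceil (t / T)|.-1.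

Lemma slotE (R : realType) (T t : R) (q : nat) :
  0 < T -> q%:R * T < t <= q.+1%:R * T -> slot T t = q.
Proof.
move=> T0; rewrite -ltr_pdivlMr// -ler_pdivrMr// => qt.
rewrite /slot (@ceil_def _ _ q.+1)//.
by rewrite -addn1 PoszD addrK -PoszD addn1.
Qed.

Lemma slot_itv (R : realType) (T t : R) : 0 < T -> 0 < t ->
  (slot T t)%:R * T < t <= (slot T t).+1%:R * T.
Proof.
move=> T0 t0; rewrite -ltr_pdivlMr// -ler_pdivrMr// /slot.
have := ceil_itv (t / T); have : 0 < Num.ceil (t / T) by rewrite ceil_gt0 divr_gt0.
case: (Num.ceil (t / T)) => [[|c]|c]//= _.
by rewrite -addn1 PoszD addrK.
Qed.

(** On positive times jumps occur only at multiples of [T], finitely many below any bound, and the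
    slot is constant close to each point on either side. *)
Lemma piecewise_continuous_slot (R : realType) (T : R) (h : nat -> R) :
  0 < T -> piecewise_continuous (fun t => h (slot T t)).
Proof.
move=> T0; split.
- move=> b; apply: (@sub_finite_set _ _
    ((fun q : nat => q.+1%:R * T) @` `I_(Num.truncn (b / T)).+1)); last first.
    exact/finite_image/finite_II.
  move=> t /= [/andP[t0 tb] tN].
  have /andP[qt] := slot_itv T0 t0; rewrite le_eqVlt => /predU1P[tE|tq].
    exists (slot T t) => //=.
    rewrite ltnS -ltnS -(ltr_nat R).
    have b0 : 0 <= b / T by rewrite divr_ge0// ltW// (lt_trans t0).
    have /andP[_] := truncn_itv b0; apply: le_lt_trans.
    by rewrite ler_pdivlMr// (le_trans (ltW qt))// ltW.
  exfalso; apply: tN; apply: cvg_near_cst.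
  have : \forall x \near t, x \in `](slot T t)%:R * T, (slot T t).+1%:R * T[.
    by apply: near_in_itvoo; rewrite in_itv/= qt.
  apply: filterS => x; rewrite in_itv/= => /andP[qx xq].
  by rewrite (slotE T0 (q := slot T t))// qx ltW.
(* Just after [t] the slot is the integer part of [t / T]; at a positive multiple of [T] this is one
   more than [slot T t]. *)
- move=> t t0; apply/cvg_ex; exists (h (Num.truncn (t / T))).
  have /andP[] := @truncn_itv _ (t / T) (divr_ge0 t0 (ltW T0)).
  rewrite ler_pdivlMr// ltr_pdivrMr// => qt tq.
  apply: cvg_near_cst; near=> x.
  rewrite (slotE T0 (q := Num.truncn (t / T)))//; apply/andP; split.
    by apply: le_lt_trans qt _; near: x; exact: nbhs_right_gt.
  by apply: ltW; near: x; exact: nbhs_right_lt.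
- move=> t t0; apply/cvg_ex; exists (h (slot T t)).
  have /andP[qt tq] := slot_itv T0 t0.
  apply: cvg_near_cst; near=> x.
  rewrite (slotE T0 (q := slot T t))//; apply/andP; split.
    by near: x; exact: nbhs_left_gt.
  by rewrite (le_trans _ tq)// ltW.
Unshelve. all: by end_near. Qed.

(** * The sampled recursion and its descent *)

Definition stage_voltage (R : realType) (alpha wd : R) (W : R -> R)
  (x : R) (i : nat) : R :=
  if i is 0 then 1 else alpha * (wd - W x).

(** The stopping test is ignored: after one probing step at voltage 1 come explicit Euler steps of
    length [T] for [x' = alpha * (wd - W x)], without end. *)
Fixpoint sampled_flux (R : realType) (alpha T wd : R) (W : R -> R) (x0 : R)
  (i : nat) : R :=
  if i is i'.+1 then
    let x := sampled_flux alpha T wd W x0 i' in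
    x + T * stage_voltage alpha wd W x i'
  else x0.

(** Otherwise the squared distance to [xs] would drop by a fixed amount forever and become negative.
    The count starts at index 1, since the probing step may move away from [xs]. *)
Lemma sampled_flux_stops (R : realType) (W : R -> R)
  (beta eps alpha T xs x0 : R) :
  strictly_monotone W -> lipschitz_with beta W ->
  0 < beta -> 0 < eps -> 0 < alpha -> 0 < T -> alpha * T < 2 / beta ->
  exists i, (0 < i)%N /\
    `|W xs - W (sampled_flux alpha T (W xs) W x0 i)| <= eps.
Proof.
move=> Wmono Wlip b0 e0 a0 T0 aT; apply: contrapT => Nstop.
set x := sampled_flux alpha T (W xs) W x0 in Nstop.
have far i : eps < `|W xs - W (x i.+1)|.
  by rewrite ltNge; apply/negP => le; apply: Nstop; exists i.+1.
have aTb : alpha * T * beta < 2 by rewrite -ltr_pdivlMr.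
(* A uniform lower bound for the drop per step, positive because [alpha * T * beta < 2]. *)
pose c := alpha * T * (2 - alpha * T * beta) * (eps ^+ 2 / beta).
have c0 : 0 < c.
  by rewrite !mulr_gt0 ?invr_gt0 ?exprn_gt0 ?subr_gt0.
have descent i : (x i.+2 - xs) ^+ 2 <= (x i.+1 - xs) ^+ 2 - c.
  (* With d = W xs - W y, y = x i.+1, strict monotonicity and the Lipschitz
     bound give d (xs - y) >= d^2 / beta, so the squared distance to xs drops
     by at least aT (2 - aT beta) d (xs - y), a = alpha. *)
  have -> : x i.+2 = x i.+1 + T * (alpha * (W xs - W (x i.+1))) by [].
  move: (far i); set y := x i.+1; set d := W xs - W y => far_i.
  have dmono : 0 <= d * (xs - y).
    by have [->|/Wmono/ltW//] := eqVneq xs y; rewrite subrr mulr0.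
  have dlip : d ^+ 2 <= beta * (d * (xs - y)).
    rewrite -[d * _]ger0_norm// normrM mulrCA -(real_normK (num_real d)).
    by rewrite expr2 ler_wpM2l// Wlip.
  have d2 : eps ^+ 2 <= d ^+ 2.
    by rewrite -(real_normK (num_real d)) lerXn2r ?nnegrE// ltW.
  have : eps ^+ 2 / beta <= d * (xs - y).
    by rewrite ler_pdivrMr// (le_trans d2)// [_ * beta]mulrC.
  move: dmono dlip; set z := d * _ => dmono dlip zlow.
  have -> : (y + T * (alpha * d) - xs) ^+ 2 =
    (y - xs) ^+ 2 - 2 * (alpha * T) * z + (alpha * T) ^+ 2 * d ^+ 2.
    by rewrite /z; ring.
  have h1 : (alpha * T) ^+ 2 * d ^+ 2 <= (alpha * T) ^+ 2 * (beta * z).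
    by rewrite ler_wpM2l// sqr_ge0.
  have h2 : c <= alpha * T * (2 - alpha * T * beta) * z.
    by rewrite ler_wpM2l// ltW// mulr_gt0 ?mulr_gt0 ?subr_gt0.
  lra.
have bound i : (x i.+1 - xs) ^+ 2 <= (x 1%N - xs) ^+ 2 - i%:R * c.
  elim: i => [|i IH]; first by rewrite mul0r subr0.
  by rewrite (le_trans (descent i))// -natr1; lra.
(* Enough steps for [K%:R * c] to exceed the squared distance at index 1. *)
pose K := (Num.truncn ((x 1%N - xs) ^+ 2 / c)).+1.
have := truncnS_gt ((x 1%N - xs) ^+ 2 / c).
rewrite ltr_pdivrMr// => lt.
have := bound K; have := sqr_ge0 (x K.+1 - xs); rewrite -/K in lt; lra.
Qed.

(** * Analysis of a single stage *)

Definition flux_rate (R : realType) (m n : nat)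
  (s : R -> 'M[bool]_(m, n)) (P : R -> 'rV[R]_n) (i : 'I_m) (j : 'I_n)
  (t : R) : R := (s t i j)%:R * P t 0 j.

Lemma fluxE (R : realType) (m n : nat) (phi0 : 'M[R]_(m, n))
  (s : R -> 'M[bool]_(m, n)) (P : R -> 'rV[R]_n) (t v : R) i j :
  integrates (flux_rate s P i j) t v -> flux phi0 s P t i j = phi0 i j + v.
Proof. by case=> _ <-; rewrite mxE. Qed.

Lemma row_current_single (R : realType) (m n : nat)
  (g : 'I_m -> 'I_n -> R -> R) (phi0 : 'M[R]_(m, n))
  (s : R -> 'M[bool]_(m, n)) (P : R -> 'rV[R]_n) (t : R) k l :
  (forall i j, s t i j = (i == k) && (j == l)) ->
  row_current g phi0 s P t k =
    - (memductance g k l (flux phi0 s P t k l) * P t 0 l).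
Proof.
move=> sE; rewrite /row_current (bigD1 l)//= sE !eqxx mulr1 big1 ?addr0//.
by move=> j jl; rewrite sE (negbTE jl) andbF mulr0.
Qed.

(** Induction on slots: each voltage fixes the next flux, that flux the next measurement, and the
    measurement the next voltage, so the samples follow [sampled_flux]. *)
Lemma array_stage_stops (R : realType) (m n : nat)
  (g : 'I_m -> 'I_n -> R -> R) (beta : R) (Wd : 'M[R]_(m, n))
  (eps alpha T : R) (phi0 : 'M[R]_(m, n)) (s : R -> 'M[bool]_(m, n))
  (P : R -> 'rV[R]_n) (That : 'I_m -> 'I_n -> \bar R)
  (k : 'I_m) (l : 'I_n) (r xs : R) (v : 'I_m -> 'I_n -> R) :
  strictly_monotone (memductance g k l) ->
  lipschitz_with beta (memductance g k l) ->
  0 < beta -> 0 < eps -> 0 < alpha -> 0 < T -> alpha * T < 2 / beta ->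
  Wd k l = memductance g k l xs ->
  0 <= r -> (forall i j, integrates (flux_rate s P i j) r (v i j)) ->
  array_stage g Wd eps alpha T phi0 s P That k l r ->
  exists t v', [/\ 0 <= t, That k l = t%:E,
    forall i j, integrates (flux_rate s P i j) (r + t) (v' i j),
    forall i j, ~~ ((i == k) && (j == l)) -> v' i j = v i j &
    `|Wd k l - memductance g k l (phi0 k l + v' k l)| <= eps].
Proof.
move=> Wmono Wlip b0 e0 a0 T0 aT WdE r0 fv [sE [u [uE]]].
rewrite /single_memristor_algorithm (fluxE phi0 (fv k l)).
set W := memductance g k l; set wd := Wd k l in WdE *.
set x0 := phi0 k l + v k l.
case: ifPn => [near That0|_ [uT usample Tstop]].
  by exists 0, v; rewrite addr0.
pose x := sampled_flux alpha T wd W x0.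
pose err i := wd + row_current g phi0 s P (r + i%:R * T) k / u (i%:R * T).
pose v' i a b := if (a == k) && (b == l) then x i - phi0 k l else v a b.
have v'0 a b : v' 0%N a b = v a b.
  rewrite /v'; case: ifP => // /andP[/eqP-> /eqP->].
  by rewrite /x /= /x0 addrAC subrr add0r.
(* Only tests strictly before [i] must have failed, so the claim reaches the stopping time itself.
   The error formula needs [0 < i], as nothing is measured at local time 0. *)
have stage i : ((i%:R * T)%:E <= That k l)%E ->
    (forall j, (1 <= j < i)%N -> eps < `|err j|) ->
    (forall a b, integrates (flux_rate s P a b) (r + i%:R * T) (v' i a b)) /\
    ((0 < i)%N -> err i = wd - W (x i)).
  elim: i => [_ _|i IH iT unst].
    by split=> // a b; rewrite mul0r addr0 v'0.
  have leT (t : R) : t <= i.+1%:R * T -> (t%:E <= That k l)%E.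
    by move=> ti; apply: le_trans iT; rewrite lee_fin.
  have iT0 : 0 <= i%:R * T by rewrite mulr_ge0// ltW.
  have iTS : i.+1%:R * T = i%:R * T + T by rewrite -natr1 mulrDl mul1r.
  have [IHf IHe] : (forall a b,
      integrates (flux_rate s P a b) (r + i%:R * T) (v' i a b)) /\
      ((0 < i)%N -> err i = wd - W (x i)).
    apply: IH; first by apply: leT; rewrite iTS lerDl ltW.
    by move=> j /andP[j1 ji]; apply: unst; rewrite j1 ltnS ltnW.
  pose c := stage_voltage alpha wd W (x i) i.
  have uc t : i%:R * T < t <= i.+1%:R * T -> u t = c.
    rewrite /c; case: i unst {IH iT leT iTS IHf c} IHe iT0 => [|i] unst IHe iT0 tT.
      apply: uT; case/andP: tT; rewrite mul0r mul1r => t0 ->.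
      by rewrite ltW.
    by rewrite (usample i.+1)// -/(err _) IHe.
  (* The next measurement divides by this voltage. Past the probing slot it is nonzero because the
     test at [i] failed. *)
  have c0 : c != 0.
    rewrite /c; case: i unst {IH iT leT iTS IHf c uc} IHe iT0 => [|i] unst IHe iT0.
      exact: oner_neq0.
    rewrite /= mulf_neq0//; first by rewrite gt_eqF.
    by rewrite -IHe// -normr_gt0 (lt_trans e0)// unst// leqnn.
  have rateE a b t : r + i%:R * T < t <= r + i.+1%:R * T ->
      flux_rate s P a b t = if (a == k) && (b == l) then c else 0.
    move=> /andP[t1 t2].
    have h1 : i%:R * T < t - r <= i.+1%:R * T.
      by rewrite ltrBrDl lerBlDl t1.
    have h2 : 0 < t - r by case/andP: h1 => /(le_lt_trans iT0).
    have h3 : ((t - r)%:E <= That k l)%E by case/andP: h1 => _ /leT.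
    rewrite /flux_rate -(subrK r t) [t - r + r]addrC sE//.
    case: ifP => [/andP[_ /eqP->]|_]; last by rewrite mul0r.
    by rewrite uE// uc// mul1r.
  have F a b : integrates (flux_rate s P a b) (r + i.+1%:R * T) (v' i.+1 a b).
    have := integrates_step _ _ (@rateE a b) (IHf a b).
    rewrite iTS opprD addrACA subrr add0r [_ + T - _]addrAC subrr add0r.
    have -> : v' i a b + T * (if (a == k) && (b == l) then c else 0) =
              v' i.+1 a b.
      rewrite /v'; case: ifP => _; last by rewrite mulr0 addr0.
      by rewrite addrAC.
    by apply; [rewrite addr_ge0|rewrite addrA lerDl ltW].
  split=> // _.
  have i0 : 0 < i.+1%:R * T by rewrite mulr_gt0.
  rewrite /err (@row_current_single _ _ _ _ _ _ _ _ k l); last first.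
    by apply: sE => //; exact: leT.
  rewrite (fluxE phi0 (F k l)) uE// uc; last by rewrite lexx andbT iTS ltrDl.
  rewrite mulNr mulfK//; congr (_ - _); congr (memductance _ _ _ _).
  by rewrite /v' !eqxx/= addrC subrK.
case: Tstop => [[i [i1 unst erri ThatE]]|[unst ThatE]].
  have [F errE] := stage i ltac:(by rewrite ThatE) (fun j ji => unst j ltac:(lia)).
  exists (i%:R * T), (v' i); split=> //.
  - by rewrite mulr_ge0// ltW.
  - by move=> a b /negbTE abkl; rewrite /v' abkl.
  - move: erri; rewrite -/(err i) errE// /v' !eqxx/=.
    by rewrite [phi0 k l + _]addrC subrK.
(* An endless stage would follow the recursion forever, yet the test succeeds at this [i]. *)
have [i [i1]] := sampled_flux_stops xs x0 Wmono Wlip b0 e0 a0 T0 aT.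
rewrite -WdE leNgt => /negP[].
have [_ errE] := stage i ltac:(by rewrite ThatE leey)
  (fun j ji => unst i j ltac:(lia)).
by rewrite -/(x i) -errE//; apply: (unst i); rewrite i1 leqnn.
Qed.

(** * The visiting order and the succession of stages *)

Definition visit_rank (m n : nat) (p : 'I_m * 'I_n) : nat := p.1 * n + p.2.

Lemma visited_beforeE (m n : nat) (p q : 'I_m * 'I_n) :
  visited_before p q = (visit_rank p < visit_rank q)%N.
Proof.
case: p q => [[k k_lt] [l l_lt]] [[k' k'_lt] [l' l'_lt]].
rewrite /visited_before /visit_rank -val_eqE /=.
by case: (ltngtP k k') => [kk'|kk'|->] /=; first 1 last; [nia|lia|nia].
Qed.

Lemma visit_rank_lt (m n : nat) (p : 'I_m * 'I_n) : (visit_rank p < m * n)%N.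
Proof.
by case: p => [[k k_lt] [l l_lt]]; rewrite /visit_rank /=; nia.
Qed.

Lemma visit_rank_inj (m n : nat) : injective (@visit_rank m n).
Proof.
move=> [[k k_lt] [l l_lt]] [[k' k'_lt] [l' l'_lt]]; rewrite /visit_rank /= => E.
have kk' : k = k' by nia.
have ll' : l = l' by move: E; rewrite kk'; lia.
by congr (_, _); exact: val_inj.
Qed.

Lemma visit_rank_onto (m n N : nat) :
  (N < m * n)%N -> exists p : 'I_m * 'I_n, visit_rank p = N.
Proof.
move=> Nmn; have n0 : (0 < n)%N by case: n Nmn; rewrite ?muln0.
have km : (N %/ n < m)%N by rewrite ltn_divLR.
have ln : (N %% n < n)%N by rewrite ltn_pmod.
by exists (Ordinal km, Ordinal ln); rewrite /visit_rank /= -divn_eq.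
Qed.

(** Induction on the number of finished stages: a stage moves only its own flux, so memristors
    written earlier stay within tolerance. *)
Lemma array_algorithm_stops (R : realType) (m n : nat)
  (g : 'I_m -> 'I_n -> R -> R) (beta : R)
  (Wd : 'M[R]_(m, n)) (eps alpha T : R) (phi0 : 'M[R]_(m, n))
  (s : R -> 'M[bool]_(m, n)) (P : R -> 'rV[R]_n)
  (That : 'I_m -> 'I_n -> \bar R) :
  (forall k l, strictly_monotone (memductance g k l)) ->
  (forall k l, lipschitz_with beta (memductance g k l)) ->
  0 < beta -> desired_memductances g Wd ->
  0 < eps -> 0 < alpha -> 0 < T -> alpha * T < 2 / beta ->
  array_algorithm g Wd eps alpha T phi0 s P That ->
  (forall k l, That k l \is a fin_num) /\
  solves_writing_problem g Wd eps phi0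
    (\sum_(k < m) \sum_(l < n) fine (That k l)) s P.
Proof.
move=> Wmono Wlip b0 [_ [xs WdE]] e0 a0 T0 aT [adm alg].
pose before N (p : 'I_m * 'I_n) := (visit_rank p < N)%N.
pose r N : R := \sum_(p | before N p) fine (That p.1 p.2).
(* Finiteness of the earlier durations belongs to the invariant: it makes the next start time real,
   which [array_algorithm] requires before it describes a stage. *)
have stages N : (N <= m * n)%N -> [/\ 0 <= r N,
    forall p, before N p -> That p.1 p.2 \is a fin_num &
    exists v : 'I_m -> 'I_n -> R,
      (forall i j, integrates (flux_rate s P i j) (r N) (v i j)) /\
      (forall p, before N p ->
        `|Wd p.1 p.2 - memductance g p.1 p.2 (phi0 p.1 p.2 + v p.1 p.2)| <= eps)].
  elim: N => [_|N IH Nmn].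
    have r00 : r 0%N = 0 by rewrite /r big_pred0.
    rewrite r00; split=> //; exists (fun _ _ => 0); split=> // i j.
    exact: integrates0.
  have [r0 fin [v [fv near]]] := IH (ltnW Nmn).
  have [[k l] klN] := visit_rank_onto Nmn.
  have beforeS p : before N.+1 p = before N p || (p == (k, l)).
    by rewrite /before ltnS leq_eqVlt orbC -klN (inj_eq (@visit_rank_inj m n)).
  have start : stage_start That k l = (r N)%:E.
    rewrite /stage_start /r -sumEFin; apply: eq_big => [p|p].
      by rewrite visited_beforeE klN.
    by rewrite visited_beforeE klN => /fin /fineK ->.
  have [/(_ _ start) stage _] := alg k l.
  have [t [v' [t0 ThatE fv' v'E nearkl]]] := array_stage_stops (Wmono k l)
    (Wlip k l) b0 e0 a0 T0 aT (WdE k l) r0 fv stage.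
  have rS : r N.+1 = r N + t.
    rewrite /r (bigD1 (k, l))/=; last by rewrite beforeS eqxx orbT.
    rewrite addrC ThatE/=; congr (_ + _); apply: eq_bigl => p.
    rewrite beforeS; case: eqVneq => [->|_]; last by rewrite orbF andbT.
    by rewrite andbF /before klN ltnn.
  rewrite rS; split.
  - by rewrite addr_ge0.
  - by move=> p; rewrite beforeS => /orP[/fin//|/eqP->]; rewrite ThatE.
  - exists v'; split=> // p; rewrite beforeS => /orP[pN|/eqP-> //].
    rewrite v'E; first exact: near.
    apply: contraTN pN => /andP[/eqP p1 /eqP p2].
    by rewrite (surjective_pairing p) p1 p2 /before klN ltnn.
have all p : before (m * n)%N p by exact: visit_rank_lt.
have [r0 fin [v [fv near]]] := stages _ (leqnn _).
have -> : \sum_(k < m) \sum_(l < n) fine (That k l) = r (m * n)%N.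
  by rewrite pair_big; apply: eq_bigl => p; rewrite all.
split=> [k l|]; first exact: (fin (k, l)).
split=> // k l; rewrite (fluxE phi0 (fv k l)); exact: (near (k, l)).
Qed.

(** * Construction of a run *)

(* [N p] is the number of slots that memristor [p] needs; the stages occupy
   consecutive blocks of slots. *)
Definition first_slot (m n : nat) (N : 'I_m * 'I_n -> nat)
  (p : 'I_m * 'I_n) : nat := \sum_(q | visited_before q p) N q.

Definition owns_slot (m n : nat) (N : 'I_m * 'I_n -> nat)
  (p : 'I_m * 'I_n) (q : nat) : bool :=
  (first_slot N p <= q < first_slot N p + N p)%N.

(** By transitivity the sum for [p'] contains the term of [p] and all the terms of the sum for
    [p]. *)
Lemma first_slot_le (m n : nat) (N : 'I_m * 'I_n -> nat) p p' :
  visited_before p p' -> (first_slot N p + N p <= first_slot N p')%N.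
Proof.
move=> pp'; rewrite /first_slot [leqRHS](bigD1 p)//= addnC leq_add2l.
rewrite [leqRHS](bigID (fun q => visited_before q p))/=.
apply: leq_trans (leq_addr _ _); rewrite leq_eqVlt; apply/orP; left; apply/eqP.
apply: eq_bigl => q; rewrite !visited_beforeE in pp' *.
case: (ltnP (visit_rank q) (visit_rank p)) => [qp|_]; last by rewrite andbF.
rewrite andbT (ltn_trans qp pp')/=.
by apply/esym; apply: contraTneq qp => ->; rewrite ltnn.
Qed.

(** Ensures that at most one switch is closed at a time in the constructed run. *)
Lemma owns_slot_inj (m n : nat) (N : 'I_m * 'I_n -> nat) p p' q :
  owns_slot N p q -> owns_slot N p' q -> p = p'.
Proof.
rewrite /owns_slot => /andP[h1 h2] /andP[h3 h4].
apply: (@visit_rank_inj m n).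
by case: (ltngtP (visit_rank p) (visit_rank p')) => //;
  rewrite -visited_beforeE => /(first_slot_le N); lia.
Qed.

(** The inputs are written down from [sampled_flux], which involves no measurement; it then remains
    to check that the measured currents prescribe these same voltages. *)
Lemma array_algorithm_exists (R : realType) (m n : nat)
  (g : 'I_m -> 'I_n -> R -> R) (beta : R)
  (Wd : 'M[R]_(m, n)) (eps alpha T : R) (phi0 : 'M[R]_(m, n)) :
  (forall k l, strictly_monotone (memductance g k l)) ->
  (forall k l, lipschitz_with beta (memductance g k l)) ->
  0 < beta -> desired_memductances g Wd ->
  0 < eps -> 0 < alpha -> 0 < T -> alpha * T < 2 / beta ->
  exists (s : R -> 'M[bool]_(m, n)) (P : R -> 'rV[R]_n)
         (That : 'I_m -> 'I_n -> \bar R),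
    array_algorithm g Wd eps alpha T phi0 s P That.
Proof.
move=> Wmono Wlip b0 [_ [xs WdE]] e0 a0 T0 aT.
pose W k l := memductance g k l.
pose x k l := sampled_flux alpha T (Wd k l) (W k l) (phi0 k l).
have stops (p : 'I_m * 'I_n) :
    exists i, (0 < i)%N && (`|Wd p.1 p.2 - W p.1 p.2 (x p.1 p.2 i)| <= eps).
  have [i [i0 xi]] := sampled_flux_stops (xs p.1 p.2) (phi0 p.1 p.2)
    (Wmono p.1 p.2) (Wlip p.1 p.2) b0 e0 a0 T0 aT.
  by exists i; rewrite i0 /x WdE.
(* Minimality makes all earlier tests fail; the index is positive because the first test takes place
   at time [T]. *)
pose N p : nat :=
  if `|Wd p.1 p.2 - W p.1 p.2 (phi0 p.1 p.2)| <= eps then 0 else ex_minn (stops p).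
pose S := first_slot N.
pose volt p q := stage_voltage alpha (Wd p.1 p.2) (W p.1 p.2)
  (x p.1 p.2 (q - S p)%N) (q - S p).
pose sw q : 'M[bool]_(m, n) := \matrix_(i, j) owns_slot N (i, j) q.
(* At most one summand is nonzero; the columns that are free get voltage 0. *)
pose vo q : 'rV[R]_n :=
  \row_j \sum_(i < m) if owns_slot N (i, j) q then volt (i, j) q else 0.
pose s t := sw (slot T t); pose P t := vo (slot T t).
have swE i j k l q : owns_slot N (k, l) q -> sw q i j = (i == k) && (j == l).
  move=> kl; rewrite mxE -xpair_eqE; apply/idP/eqP => [ij|-> //].
  exact: owns_slot_inj ij kl.
have voE k l q : owns_slot N (k, l) q -> vo q 0 l = volt (k, l) q.
  move=> kl; rewrite mxE (bigD1 k)//= kl big1 ?addr0// => i ik.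
  case: ifP => // il; case: (owns_slot_inj il kl) => ikE.
  by rewrite ikE eqxx in ik.
have Tge (q : nat) : 0 <= q%:R * T by rewrite mulr_ge0// ltW.
(* Truncated subtraction and [minn] encode three phases: the flux waits before its block, follows
   the recursion inside it, and is frozen afterwards. *)
have fluxq (i : 'I_m) (j : 'I_n) q : integrates (flux_rate s P i j) (q%:R * T)
    (x i j (minn (q - S (i, j)) (N (i, j))) - phi0 i j).
  elim: q => [|q IH].
    by rewrite mul0r sub0n min0n subrr; exact: integrates0.
  pose c := if owns_slot N (i, j) q then volt (i, j) q else 0.
  have rateE t : q%:R * T < t <= q.+1%:R * T -> flux_rate s P i j t = c.
    move=> tq; rewrite /flux_rate /s /P (slotE T0 tq) /c.
    case: ifPn => [ijq|ijq]; last by rewrite mxE (negbTE ijq) mul0r.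
    by rewrite (swE _ _ _ _ _ ijq) !eqxx mul1r (voE _ _ _ ijq).
  have qS : q.+1%:R * T - q%:R * T = T by rewrite -natr1 mulrDl mul1r addrAC subrr add0r.
  have le_q : q%:R * T <= q.+1%:R * T by rewrite ler_pM2r// ler_nat.
  have := integrates_step (Tge q) le_q rateE IH; rewrite qS.
  set v := (X in integrates _ _ X -> _); set v' := (X in _ -> integrates _ _ X).
  have -> : v = v'.
    rewrite /v /v' /c /owns_slot -/(S (i, j)).
    case: ifPn => [/andP[Sq qN]|].
      rewrite subSn// (minn_idPl _); last by lia.
      by rewrite (minn_idPl _) /=; [rewrite addrAC|lia].
    rewrite mulr0 addr0 => out; congr (x _ _ _ - _); lia.
  by [].
exists s, P, (fun k l => ((N (k, l))%:R * T)%:E); split.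
  split=> [i j|j].
    exact: (piecewise_continuous_slot (fun q => (sw q i j)%:R) T0).
  exact: (piecewise_continuous_slot (fun q => vo q 0 j) T0).
have start k l : stage_start (fun k l => ((N (k, l))%:R * T)%:E) k l =
    ((S (k, l))%:R * T)%:E.
  rewrite /stage_start sumEFin -mulr_suml -natr_sum; congr ((_%:R * _)%:E).
  by apply: eq_bigr => -[].
move=> k l; split; last by rewrite start.
move=> r; rewrite start => -[<-] {r}.
set r := (S (k, l))%:R * T.
have slotr t i : i%:R * T < t <= i.+1%:R * T -> slot T (r + t) = (S (k, l) + i)%N.
  move=> ti; apply: slotE => //.
  by rewrite -addnS !natrD !mulrDl ltrD2l lerD2l.
have owns i : (i < N (k, l))%N -> owns_slot N (k, l) (S (k, l) + i).
  by move=> iN; rewrite /owns_slot -/(S (k, l)); lia.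
have Pslot t i : (i < N (k, l))%N -> i%:R * T < t <= i.+1%:R * T ->
    P (r + t) 0 l = stage_voltage alpha (Wd k l) (W k l) (x k l i) i.
  move=> iN ti; rewrite /P (slotr _ _ ti) (voE _ _ _ (owns _ iN)).
  by rewrite /volt /= addKn.
have sE t : 0 < t -> (t%:E <= ((N (k, l))%:R * T)%:E)%E ->
    forall i j, s (r + t) i j = (i == k) && (j == l).
  rewrite lee_fin => t0 tN i j.
  have ti := slot_itv T0 t0.
  rewrite /s (slotr _ _ ti); apply/swE/owns.
  rewrite -(ltr_nat R) -(ltr_pM2r T0) (lt_le_trans _ tN)//.
  by case/andP: ti.
split=> //.
(* The local voltage must be 1 at local time 0 too, whereas the global instant [r] may still belong
   to the previous block. *)
pose u t := if t <= 0 then 1 else P (r + t) 0 l.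
exists u; split=> [t t0 _|]; first by rewrite /u leNgt t0.
have r0 : 0 <= r := Tge _.
have -> : memductance g k l (flux phi0 s P r k l) = W k l (phi0 k l).
  by rewrite (fluxE phi0 (fluxq k l (S (k, l)))) subnn min0n /= subrr addr0.
rewrite /single_memristor_algorithm.
have NE : N (k, l) = if `|Wd k l - W k l (phi0 k l)| <= eps then 0%N
  else ex_minn (stops (k, l)) by [].
case: ifPn NE => [_ ->|_]; first by rewrite mul0r.
case: ex_minnP => N0 /= /andP[N0_gt0 N0_near] N0_min NE.
have unear i : (0 < i < N0)%N -> eps < `|Wd k l - W k l (x k l i)|.
  move=> /andP[i0 iN]; rewrite ltNge; apply: contraTN iN => near.
  by rewrite -leqNgt N0_min// i0 near.
have uslot t i : (i < N0)%N -> i%:R * T < t <= i.+1%:R * T ->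
    u t = stage_voltage alpha (Wd k l) (W k l) (x k l i) i.
  move=> iN ti; rewrite /u leNgt (le_lt_trans (Tge i)) ?(Pslot t i)//; last 2 first.
  - by rewrite NE.
  - by case/andP: ti.
have itvr (i : nat) : i%:R * T < i.+1%:R * T <= i.+1%:R * T.
  by rewrite lexx andbT ltr_pM2r// ltr_nat.
pose err i := Wd k l +
  row_current g phi0 s P (r + i%:R * T) k / u (i%:R * T).
(* At time [i%:R * T] the voltage is still that of slot [i.-1]: it is 1 for [i = 1], and otherwise
   nonzero because the test at [i.-1] failed. *)
have errE i : (0 < i <= N0)%N -> err i = Wd k l - W k l (x k l i).
  case: i => // i /andP[_ iN].
  rewrite /err (uslot _ _ iN (itvr i)) (@row_current_single _ _ _ _ _ _ _ _ k l); last first.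
    apply: sE; first by rewrite mulr_gt0.
    by rewrite lee_fin NE ler_pM2r// ler_nat.
  rewrite (Pslot _ _ _ (itvr i)) ?NE//.
  rewrite mulNr mulfK; last first.
    case: i iN => [|i] iN /=; first exact: oner_neq0.
    rewrite mulf_neq0//; first by rewrite gt_eqF.
    by rewrite -normr_gt0 (lt_trans e0)// unear//=; lia.
  have := fluxE phi0 (fluxq k l (S (k, l) + i.+1)%N).
  rewrite addKn NE (minn_idPl iN) natrD mulrDl => ->.
  by rewrite [phi0 k l + _]addrC subrK.
split.
- move=> t /andP[t0 tT]; have [t_le0|t_gt0] := leP t 0; first by rewrite /u t_le0.
  by rewrite (uslot t 0%N)// mul0r t_gt0 mul1r.
- move=> i i1 unst t ti; rewrite -/(err i).
  (* From [N0] on, [unst] would contradict the successful test at [N0]. *)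
  have iN : (i < N0)%N.
    rewrite ltnNge; apply/negP => Ni.
    have : eps < `|err N0| by apply: unst; rewrite N0_gt0.
    by rewrite errE ?N0_gt0 ?leqnn// ltNge N0_near.
  rewrite (uslot _ _ iN ti) errE; last by rewrite i1 ltnW.
  by case: i i1 {unst ti iN}.
- left; exists N0; split=> //; last by rewrite NE.
  + move=> j /andP[j1 jN]; rewrite -/(err j) errE ?unear//; lia.
  + by rewrite -/(err N0) errE ?N0_gt0 ?leqnn.
Qed.

(** The algorithm is a relation that leaves some inputs free, so the guarantee covers every run, and
    the existence of a run keeps it from being vacuous. *)
Theorem corollary1 (R : realType) (m n : nat) (m_gt0 : (0 < m)%N)
  (n_gt0 : (0 < n)%N) (g : 'I_m -> 'I_n -> R -> R) (beta : R)
  (g_C1 : forall k l, cont_differentiable (g k l))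
  (g_mono : forall k l, strictly_monotone (g k l))
  (W_mono : forall k l, strictly_monotone (memductance g k l))
  (beta_gt0 : 0 < beta)
  (W_lip : forall k l, lipschitz_with beta (memductance g k l))
  (Wd : 'M[R]_(m, n)) (Wd_D : desired_memductances g Wd)
  (eps : R) (eps_gt0 : 0 < eps)
  (alpha T : R) (alpha_gt0 : 0 < alpha) (T_gt0 : 0 < T)
  (alphaT_lt : alpha * T < 2 / beta) (phi0 : 'M[R]_(m, n)) :
  (exists (s : R -> 'M[bool]_(m, n)) (P : R -> 'rV[R]_n)
          (That : 'I_m -> 'I_n -> \bar R),
     array_algorithm g Wd eps alpha T phi0 s P That) /\
  (forall (s : R -> 'M[bool]_(m, n)) (P : R -> 'rV[R]_n)
          (That : 'I_m -> 'I_n -> \bar R),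
     array_algorithm g Wd eps alpha T phi0 s P That ->
     (forall k l, That k l \is a fin_num) /\
     solves_writing_problem g Wd eps phi0
       (\sum_(k < m) \sum_(l < n) fine (That k l)) s P).
Proof.
split; first exact: (array_algorithm_exists (beta := beta)).
by move=> s P That; exact: (array_algorithm_stops (beta := beta)).
Qed.
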